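(* There exists $t_0$ such that for every integer $t\geq t_0$, $$b_{2,S_t}\leq \left(\frac{\sqrt{2}}{2}\binom{2t-2}{t-1}\right)^{\frac{2t-3}{4t-7}}.$$
   Context: For a positive integer $t$, $S_t$ denotes the star with $t$ edges (and $t+1$ vertices). For a positive integer $r$ and graphs $G,H$ (simple graphs), $c_{r,H}(G)$ is the number of $r$-edge-colorings of $G$ (functions $c:E(G)\to\{1,\dots,r\}$) with no monochromatic copy of $H$ as a subgraph. $c_{r,H}(n)$ is the maximum of $c_{r,H}(G)$ over all graphs $G$ on $n$ vertices. For connected $H$, the function $n\mapsto c_{r,H}(n)$ is supermultiplicative, so the limit $b_{r,H}=\lim_{n\to\infty} c_{r,H}(n)^{1/n}\in\mathbb{R}\cup\{\infty\}$ exists. *)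

(* Defs.v *)
From HB Require Import structures.
From mathcomp Require Import all_boot all_order all_algebra.
From mathcomp Require Import all_classical all_reals all_analysis.

Set Implicit Arguments.
Unset Strict Implicit.
Unset Printing Implicit Defensive.

Import Order.TTheory GRing.Theory Num.Theory.

Record sgraph (V : finType) := SGraph {
  edges : {set {set V}};
  edges_card2 : [forall e in edges, #|e| == 2] }.

HB.instance Definition _ (V : finType) := [isSub for @edges V].
HB.instance Definition _ (V : finType) := [Finite of sgraph V by <:].

(* Not necessarily induced copies. *)
Definition has_copy (V W : finType) (G : sgraph V) (H : sgraph W) : bool :=
  [exists f : {ffun W -> V},
    injectiveb f && [forall e in edges H, (f @: e) \in edges G]].

Definition edge_coloring (r : nat) (V : finType) (G : sgraph V) :=
  {ffun {e : {set V} | e \in edges G} -> 'I_r}.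

Definition color_edges (r : nat) (V : finType) (G : sgraph V)
    (c : edge_coloring r G) (i : 'I_r) : {set {set V}} :=
  [set val e | e : {e : {set V} | e \in edges G} & c e == i].

Lemma color_edges_card2 (r : nat) (V : finType) (G : sgraph V)
    (c : edge_coloring r G) (i : 'I_r) :
  [forall e in color_edges c i, #|e| == 2].
Proof.
apply/forall_inP => e /imsetP[[e' e'G] _ ->] /=.
exact: (forall_inP (edges_card2 G)).
Qed.

Definition color_class (r : nat) (V : finType) (G : sgraph V)
    (c : edge_coloring r G) (i : 'I_r) : sgraph V :=
  SGraph (color_edges_card2 c i).

Definition monochromatic_copy (r : nat) (V W : finType) (H : sgraph W)
    (G : sgraph V) (c : edge_coloring r G) : bool :=
  [exists i : 'I_r, has_copy (color_class c i) H].

Definition num_colorings (r : nat) (V W : finType) (H : sgraph W)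
    (G : sgraph V) : nat :=
  #|[set c : edge_coloring r G | ~~ monochromatic_copy H c]|.

Definition max_colorings (r : nat) (W : finType) (H : sgraph W) (n : nat)
    : nat :=
  \max_(G : sgraph 'I_n) num_colorings r H G.

(* The limit is taken in the extended reals. For connected H (with at least
   one edge) it exists, in [1, +oo], because max_colorings r H is
   supermultiplicative and positive. *)
Definition growth_limit (R : realType) (r : nat) (W : finType) (H : sgraph W)
    : \bar R :=
  limn (fun n : nat => ((max_colorings r H n)%:R `^ (n%:R^-1))%:E : \bar R)%R.

Definition star_edges (t : nat) : {set {set 'I_t.+1}} :=
  [set [set ord0; lift ord0 i] | i : 'I_t].

Lemma star_edges_card2 (t : nat) : [forall e in star_edges t, #|e| == 2].
Proof. by apply/forall_inP => e /imsetP[i _ ->]; rewrite cards2. Qed.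

Definition star (t : nat) : sgraph 'I_t.+1 := SGraph (star_edges_card2 t).

(* Main.v *)
(* Put t = m + 1. Colorings without a monochromatic star are those in which each color
   has degree at most m everywhere; a vertex of degree d admits [bal m d] colorings of its
   incident edges, and, exchanging the colors, the edges meeting a given edge uv admit at
   most [bal m d_u * bal m d_v / 2] colorings. Weighted Shearer, applied to the stars at
   vertices and the double stars at edges, bounds the logarithm of the number of colorings
   by a sum of costs depending only on the degree of each vertex. A uniform weighting of
   the double stars is not good enough when degrees 2m and 2m - 1 (both with
   [bal m d = 'C(2 m, m)]) are mixed; weighting the double star at uv by
   [vweight d_u + vweight d_v], with a slightly smaller value at degree 2m, makes every
   cost at most that of degree 2m - 1, which is the logarithm of the claimed bound. *)
Require Import Defs.
From mathcomp Require Import all_boot all_order all_algebra.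
From mathcomp Require Import all_classical all_reals all_analysis.
From mathcomp Require Import finset zify ring lra.

Set Implicit Arguments.
Unset Strict Implicit.
Unset Printing Implicit Defensive.

Import Order.TTheory GRing.Theory Num.Theory.

Local Open Scope ring_scope.

(** * Shearer's inequality *)

Section Shearer.
Variable R : realType.

Lemma powR_sumr (I : finType) (a : R) (w : I -> R) : 0 < a ->
  \prod_i a `^ w i = a `^ (\sum_i w i).
Proof.
move=> a0; elim/big_rec2 : _ => [|i y1 y2 _ ->]; first by rewrite powRr0.
by rewrite powRD // (gt_eqF a0) implybT.
Qed.

(** Weighted AM-GM bounds the product by the mean [mu] raised to the total weight; as [mu] is at
    most 1 and the total weight at least 1, this power is at most [mu]. *)
Lemma prod_powR_le_mean (I : finType) (w p : I -> R) :
  (forall i, 0 <= w i) -> 1 <= \sum_i w i -> (forall i, 0 <= p i <= 1) ->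
  \prod_i p i `^ w i <= (\sum_i w i * p i) / \sum_i w i.
Proof.
move=> w0 W1 p01; set W := \sum_i w i in W1 *.
have W0 : 0 < W by apply: lt_le_trans W1.
have wp0 i : 0 <= w i * p i by rewrite mulr_ge0 //; case/andP: (p01 i).
set mu := _ / W.
have mu0 : 0 <= mu by rewrite divr_ge0 ?sumr_ge0 // ltW.
have [mu_eq0|mu_neq0] := eqVneq mu 0.
  have [i wi_neq0] : exists i, w i != 0.
    apply/existsP; rewrite -negb_forall; apply/negP => /forallP h.
    by move: W0; rewrite /W big1 ?ltxx // => i _; apply/eqP.
  have : \sum_i w i * p i == 0.
    by move/eqP: mu_eq0; rewrite mulf_eq0 invr_eq0 (gt_eqF W0) orbF.
  rewrite psumr_eq0 // => /allP /(_ i (mem_index_enum _)) /=.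
  rewrite mulf_eq0 (negbTE wi_neq0) /= => /eqP pi0.
  by rewrite (bigD1 i) //= pi0 powR0 // mul0r.
have mu_gt0 : 0 < mu by rewrite lt_def mu_neq0.
have mu_le1 : mu <= 1.
  rewrite ler_pdivrMr // mul1r ler_sum // => i _.
  by rewrite ler_piMr //; case/andP: (p01 i).
(* p <= mu * exp (p / mu - 1), and the exponents w_i (p_i / mu - 1) sum to 0. *)
apply: (@le_trans _ _ (\prod_i (mu `^ w i * expR (w i * (p i / mu - 1))))).
  apply: ler_prod => i _; rewrite powR_ge0 /=.
  rewrite [w i * (_ - _)]mulrC expRM -powRM ?expR_ge0 //.
  apply: ge0_ler_powR => //; rewrite ?nnegrE.
  - by case/andP: (p01 i).
  - by rewrite mulr_ge0 ?expR_ge0.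
  rewrite -ler_pdivrMl // mulrC.
  by apply: le_trans (expR_ge1Dx _); rewrite addrC subrK.
rewrite big_split /= powR_sumr // -expR_sum.
rewrite (_ : \sum_i w i * (p i / mu - 1) = 0) ?expR0 ?mulr1; last first.
  under eq_bigr do rewrite mulrBr mulr1 mulrA.
  rewrite sumrB -mulr_suml -/W /mu invf_div mulrCA divff ?mulr1 ?subrr //.
  by apply: contraNneq mu_neq0 => h; rewrite /mu h mul0r.
by apply: ge1r_powR => //; rewrite mu_gt0.
Qed.

(* Hölder's inequality, for exponents of sum at least 1. *)
Lemma sum_prod_powR_le (I J : finType) (w : J -> R) (a : I -> J -> R) :
    (forall j, 0 <= w j) -> 1 <= \sum_j w j ->
    (forall i j, 0 <= a i j) -> (forall j, 0 < \sum_i a i j) ->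
  \sum_i \prod_j a i j `^ w j <= \prod_j (\sum_i a i j) `^ w j.
Proof.
move=> w0 W1 a0 b0; pose b j := \sum_i a i j.
have W0 : 0 < \sum_j w j by apply: lt_le_trans W1.
pose p i j := a i j / b j.
have b_ge0 j : 0 <= b j by apply/ltW/b0.
have p01 i j : 0 <= p i j <= 1.
  apply/andP; split; first exact: divr_ge0.
  by rewrite ler_pdivrMr ?b0 // mul1r /b (bigD1 i) //= lerDl sumr_ge0.
have aE i : \prod_j a i j `^ w j = (\prod_j p i j `^ w j) * \prod_j b j `^ w j.
  rewrite -big_split; apply: eq_bigr => j _ /=.
  rewrite -powRM // ?divfK ?gt_eqF ?b0 //; by case/andP: (p01 i j).
rewrite (eq_bigr _ (fun i _ => aE i)).
rewrite -mulr_suml ler_piMl ?prodr_ge0 // => [j _|]; first exact: powR_ge0.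
apply: (@le_trans _ _ (\sum_i (\sum_j w j * p i j) / \sum_j w j)).
  by apply: ler_sum => i _; apply: prod_powR_le_mean.
rewrite -mulr_suml ler_pdivrMr // mul1r exchange_big ler_sum // => j _.
by rewrite -mulr_sumr /p -mulr_suml divff ?mulr1 // gt_eqF ?b0.
Qed.

Definition trace (T : finType) (F : {set {set T}}) (A : {set T}) :=
  [set X :&: A | X in F].

Lemma trace_subset (T : finType) (F F' : {set {set T}}) (A : {set T}) :
  F \subset F' -> (#|trace F A| <= #|trace F' A|)%N.
Proof. by move=> FF'; apply/subset_leq_card/imsetS. Qed.

Lemma card_trace_gt0 (T : finType) (F : {set {set T}}) (A : {set T}) :
  F != set0 -> (0 < #|trace F A|)%N.
Proof.
by case/set0Pn => X XF; apply/card_gt0P; exists (X :&: A); apply: imset_f.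
Qed.

(** Removing [e] is injective on the traces that contain [e], and also on those that avoid it. *)
Lemma card_trace_split (T : finType) (F : {set {set T}}) (A : {set T}) (e : T) :
  e \in A ->
  #|trace F A| = \sum_(b : bool) #|trace [set X in F | (e \in X) == b] (A :\ e)|.
Proof.
move=> eA; pose F' b := [set X in F | (e \in X) == b].
have trE b : #|[set Y in trace F A | (e \in Y) == b]| = #|trace (F' b) (A :\ e)|.
  rewrite -(card_in_imset (f := fun Y => Y :\ e)); last first.
    move=> Y Z; rewrite !inE => /andP[_ /eqP eY] /andP[_ /eqP eZ] YZ.
    apply/setP => x; have [->|xe] := eqVneq x e; first by rewrite eY eZ.
    by move/setP/(_ x): YZ; rewrite !inE xe.
  congr #|pred_of_set _|; apply/setP => Y; apply/imsetP/imsetP.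
    case=> Z; rewrite !inE => /andP[/imsetP[X XF ->]]; rewrite inE eA andbT => eX ->.
    by exists X; rewrite ?inE ?XF ?setIDA.
  case=> X; rewrite inE => /andP[XF eX ->]; exists (X :&: A).
    by rewrite !inE eA andbT eX andbT; apply: imset_f.
  by rewrite setIDA.
rewrite -[LHS]sum1_card.
rewrite (partition_big (J := bool) (fun Y : {set T} => e \in Y) predT) //=.
by apply: eq_bigr => b _; rewrite sum1dep_card -trE.
Qed.

(** Cutting everything down to [U] allows induction on [#|U|]. For [e] in [U], split [F] by
    membership of [e] and apply the induction hypothesis to both halves over [U :\ e]. Factors with
    [e] outside [S j] only grow on returning to [F]; the others have total weight at least 1, and
    Hölder's inequality sums them over the two halves. *)
Lemma shearer_restr (T J : finType) (w : J -> R) (S : J -> {set T})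
    (F : {set {set T}}) (U : {set T}) :
    (forall j, 0 <= w j) ->
    (forall e, e \in U -> 1 <= \sum_(j | e \in S j) w j) -> F != set0 ->
  #|trace F U|%:R <= \prod_j #|trace F (S j :&: U)|%:R `^ w j.
Proof.
move=> w0; move: {2}#|U| (erefl #|U|) => n.
elim: n => [|n IHn] in U F * => [U0|nU] cov F0.
  have -> : U = set0 by apply/eqP; rewrite -cards_eq0 U0.
  have -> : trace F set0 = [set set0].
    apply/setP => Y; rewrite inE; apply/imsetP/eqP => [[X _ ->]|->].
      by rewrite setI0.
    by case/set0Pn: F0 => X XF; exists X; rewrite ?setI0.
  rewrite cards1; elim/big_rec: _ => // j y _ y1.
  apply: mulr_ege1 => //; rewrite -[leLHS](powRr0 #|trace F (S j :&: set0)|%:R).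
  by apply: ler_powR; rewrite ?ler1n ?card_trace_gt0.
have [e eU] : exists e, e \in U by apply/set0Pn; rewrite -card_gt0 nU.
pose F' b := [set X in F | (e \in X) == b].
have F'F b : F' b \subset F by apply/fintype.subsetP => X; rewrite inE => /andP[].
have nUe : #|U :\ e| = n by have := cardsD1 e U; rewrite eU nU => -[].
rewrite (card_trace_split _ eU) natr_sum.
pose a (b : bool) j : R := #|trace (F' b) (S j :&: (U :\ e))|%:R.
have IH b : #|trace (F' b) (U :\ e)|%:R <= \prod_j a b j `^ w j.
  have [F'0|F'0] := eqVneq (F' b) set0.
    by rewrite F'0 /trace imset0 cards0 prodr_ge0 // => j _; apply: powR_ge0.
  by apply: IHn => // x; rewrite !inE => /andP[_]; apply: cov.
apply: (le_trans (ler_sum _ (fun b _ => IH b))).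
pose h b := \prod_(j | e \notin S j) #|trace F (S j :&: U)|%:R `^ w j *
   \prod_(j | e \in S j) a b j `^ w j.
apply: (@le_trans _ _ (\sum_b h b)).
  apply: ler_sum => b _; rewrite (bigID (fun j => e \notin S j)) /= /h.
  under [X in _ * X <= _]eq_bigl do rewrite negbK.
  rewrite ler_wpM2r ?prodr_ge0 // => [j _|]; first exact: powR_ge0.
  apply: ler_prod => j eS; rewrite powR_ge0 /=.
  apply: ge0_ler_powR; rewrite ?nnegrE ?ler0n // ler_nat.
  rewrite setIDA (setDidPl _) ?trace_subset //.
  by rewrite fintype.disjoint_sym disjoints1 inE (negbTE eS).
rewrite /h -mulr_sumr [leRHS](bigID (fun j => e \notin S j)) /=.
apply: ler_wpM2l; first by apply: prodr_ge0 => j _; apply: powR_ge0.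
under [leRHS]eq_bigl do rewrite negbK.
(* Exponent 0 turns a factor into 1, whatever its base, so Hölder's inequality can be applied over
   all of [J]. *)
pose w' j := if e \in S j then w j else 0.
have w'E (x : J -> R) : \prod_(j | e \in S j) x j `^ w j = \prod_j x j `^ w' j.
  by rewrite big_mkcond; apply: eq_bigr => j _; rewrite /w'; case: ifP; rewrite ?powRr0.
under eq_bigr do rewrite w'E.
have trE j : e \in S j -> \sum_b a b j = #|trace F (S j :&: U)|%:R.
  by move=> eS; rewrite (@card_trace_split _ _ _ e) ?inE ?eS // natr_sum -setIDA.
rewrite [leRHS](_ : _ = \prod_j (\sum_b a b j) `^ w' j); last first.
  by rewrite -w'E; apply: eq_bigr => j eS; rewrite trE.
apply: sum_prod_powR_le => [j||//|j].
- by rewrite /w'; case: ifP.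
- by rewrite -big_mkcond; apply: cov.
rewrite -natr_sum ltr0n; case/set0Pn: F0 => X XF.
rewrite (bigD1 (e \in X)) //= addn_gt0 card_trace_gt0 //.
by apply/set0Pn; exists X; rewrite inE XF /=.
Qed.

(* The weighted form of Shearer's inequality, with projections replaced by traces. *)
Lemma shearer (T J : finType) (w : J -> R) (S : J -> {set T})
    (F : {set {set T}}) (U : {set T}) :
    (forall j, 0 <= w j) ->
    (forall e, e \in U -> 1 <= \sum_(j | e \in S j) w j) ->
    (forall X, X \in F -> X \subset U) -> F != set0 ->
  #|F|%:R <= \prod_j #|trace F (S j)|%:R `^ w j.
Proof.
move=> w0 cov FU F0.
have trU A : trace F (A :&: U) = trace F A.
  by apply: eq_in_imset => X XF; rewrite [A :&: U]setIC setIA (setIidPl (FU _ XF)).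
have -> : #|F| = #|trace F U|.
  by rewrite -[U]setTI trU /trace; under eq_imset do rewrite setIT; rewrite imset_id.
under eq_bigr do rewrite -trU.
exact: shearer_restr.
Qed.

End Shearer.

(** * Balanced two-colorings of a set *)

(* Counts the ways to color d edges with two colors, each used at most m times. *)
Definition bal (m d : nat) : nat := (\sum_(d - m <= i < m.+1) 'C(d, i))%N.

Lemma balE m d : bal m d = (\sum_(i < m.+1 | d <= m + i) 'C(d, i))%N.
Proof.
by rewrite /bal big_geq_mkord; apply: eq_bigl => i; rewrite leq_subLR.
Qed.

(** By Pascal's rule the left sum consists of two copies of [bal m d], one without its top term
    [i = m], the other without its bottom term [i = d - m]; both missing terms equal ['C(d, m)],
    which vanishes when [d < m]. *)
Lemma balS m d : (d <= 2 * m)%N -> (bal m d.+1 + 2 * 'C(d, m) = 2 * bal m d)%N.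
Proof.
move=> dm.
have e1 : (\sum_(i < m.+1 | d <= m + i) 'C(d, i) =
    \sum_(i < m | d <= m + i) 'C(d, i) + 'C(d, m))%N.
  rewrite big_mkcond big_ord_recr /= -big_mkcond /=.
  by congr addn; rewrite addnn -mul2n dm.
have e2 : (\sum_(i < m.+1 | d <= m + i) 'C(d, i) =
    \sum_(i < m.+1 | d < m + i) 'C(d, i) + 'C(d, m))%N.
  have [md|dm'] := leqP m d; last first.
    rewrite bin_small // addn0; apply: eq_bigl => i.
    by rewrite !(leq_trans (ltnW dm')) ?leq_addr // (leq_trans dm') ?leq_addr.
  have dmm : (d - m < m.+1)%N by rewrite ltnS leq_subLR addnn -mul2n.
  rewrite (bigD1 (Ordinal dmm)) /= ?subnKC // addnC; congr addn.
    apply: eq_bigl => i; rewrite ltn_neqAle andbC; congr andb.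
    by rewrite -(inj_eq val_inj) /= -(eqn_add2l m) subnKC // eq_sym.
  by rewrite bin_sub.
have -> : (bal m d.+1 =
    \sum_(i < m.+1 | d < m + i) 'C(d, i) + \sum_(i < m | d <= m + i) 'C(d, i))%N.
  rewrite balE.
  rewrite [in LHS]big_mkcond [X in _ = (X + _)%N]big_mkcond !big_ord_recl /= !bin0.
  rewrite [X in _ = (_ + X)%N]big_mkcond /= -addnA; congr addn; rewrite -big_split.
  apply: eq_bigr => i _; rewrite /= /bump /= add1n addnS ltnS binS.
  by case: ifP.
by move: e1 e2; rewrite -balE; lia.
Qed.

Lemma leq_binS n k : (n <= 2 * k + 1)%N -> ('C(n, k.+1) <= 'C(n, k))%N.
Proof.
move=> nk; rewrite -(leq_pmul2l (ltn0Sn k)) mul_bin_left leq_mul2r.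
by apply/orP; right; lia.
Qed.

Lemma bal_2m m : bal m (2 * m) = 'C(2 * m, m).
Proof. by rewrite /bal (_ : 2 * m - m = m)%N ?big_nat1 //; lia. Qed.

Lemma bal_2m1 m : (0 < m)%N -> bal m (2 * m).-1 = 'C(2 * m, m).
Proof.
case: m => // m _; rewrite /bal (_ : ((2 * m.+1).-1 - m.+1)%N = m); last lia.
rewrite big_ltn ?big_nat1; last lia.
by rewrite (_ : 2 * m.+1 = (2 * m.+1).-1.+1)%N ?binS 1?addnC //; lia.
Qed.

Lemma bin_2m2 m : 'C((2 * m).+2, m.+1) = (2 * ('C(2 * m, m.+1) + 'C(2 * m, m)))%N.
Proof.
rewrite [LHS]binS (_ : 'C((2 * m).+1, m) = 'C((2 * m).+1, m.+1)); last first.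
  by rewrite -bin_sub; [congr ('C(_, _))|]; lia.
by rewrite binS; lia.
Qed.

(** A ratio of 3 / 4 suffices for [vertex_cost] at degree 2m - 2, because its cube is below 1 /
    2. *)
Lemma bal_2m2 m : (0 < m)%N -> (4 * bal m (2 * m - 2) <= 3 * 'C(2 * m, m))%N.
Proof.
case: m => // m _; have := @bal_2m1 m.+1 isT; have := @balS m.+1 (2 * m).
rewrite (_ : 2 * m.+1 = (2 * m).+2)%N /=; last lia.
rewrite subn2 /= => + h; rewrite {}h bin_2m2; have := @leq_binS (2 * m) m.
lia.
Qed.

Lemma bal_2m3 m : (1 < m)%N -> (2 * bal m (2 * m - 3) <= 'C(2 * m, m))%N.
Proof.
case: m => // m m0; have := @bal_2m2 m.+1 isT; have := @balS m.+1 (2 * m).-1.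
have := @leq_binS (2 * m).-1 m; have := @leq_binS (2 * m) m.
have := binS (2 * m).-1 m; rewrite prednK; last lia.
rewrite (_ : 2 * m.+1 = (2 * m).+2)%N /=; last lia.
rewrite [((2 * m).+2 - 2)%N]subn2 [((2 * m).+2 - 3)%N](_ : _ = (2 * m).-1) /=; last lia.
rewrite bin_2m2; lia.
Qed.

(** By [balS] it is enough that [bal m d] is at least [2 * 'C(d, m)]: for [m <= d < 2 * m] its end
    terms [i = d - m] and [i = m] are distinct and both equal ['C(d, m)]. *)
Lemma leq_balS m d : (d < 2 * m)%N -> (bal m d <= bal m d.+1)%N.
Proof.
move=> dm; have := @balS m d (ltnW dm).
suff : (2 * 'C(d, m) <= bal m d)%N by lia.
have [md|dm'] := leqP m d; last by rewrite bin_small.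
rewrite /bal big_ltn; last lia.
rewrite (big_cat_nat _ (n := m)) /=; try lia.
by rewrite big_nat1 bin_sub //; lia.
Qed.

Lemma leq_bal m d d' : (d <= d')%N -> (d' <= 2 * m)%N -> (bal m d <= bal m d')%N.
Proof.
elim: d' => [|d' IH]; first by rewrite leqn0 => /eqP ->.
rewrite leq_eqVlt => /predU1P[->//|]; rewrite ltnS => /IH{}IH d'm.
by rewrite (leq_trans (IH (ltnW d'm))) ?leq_balS.
Qed.

(** Serves [vertex_cost] at degree 2m. The induction starts from 16 <= 20; at m = 2 the bound fails,
    since 8 > 6. *)
Lemma exp2_le_bin m : (3 <= m)%N -> (2 ^ m.+1 <= 'C(2 * m, m))%N.
Proof.
elim: m => // m IH; rewrite leq_eqVlt => /predU1P[<-//|]; rewrite ltnS => /IH{}IH.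
have -> : (2 * m.+1 = (2 * m).+2)%N by lia.
rewrite expnS bin_2m2; lia.
Qed.

Lemma card_balanced (T : finType) (m : nat) (A : {set T}) :
  #|[set Y : {set T} | [&& Y \subset A, #|Y| <= m & #|A :\: Y| <= m]]%N| = bal m #|A|.
Proof.
rewrite balE -[LHS]sum1_card (partition_big (fun Y : {set T} => inord #|Y| : 'I_m.+1)
  (fun i : 'I_m.+1 => #|A| <= m + i)%N) /=; last first.
  move=> Y; rewrite inE => /and3P[YA Ym AYm]; rewrite inordK // -leq_subLR.
  by move: AYm; rewrite cardsD (setIidPr YA); lia.
apply: eq_bigr => i Ai; rewrite sum1dep_card -cards_draws; apply: eq_card => Y.
rewrite !inE; have [YA|//] := boolP (Y \subset A); rewrite /= cardsD (setIidPr YA).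
apply/andP/eqP => [[/andP[Ym _] /eqP <-]|Yi]; first by rewrite inordK.
split; last by rewrite -val_eqE /= inordK Yi.
by rewrite Yi leq_subLR [(i + m)%N]addnC Ai andbT -ltnS.
Qed.

(** Complementation in [A] exchanges the two colors, hence the balanced sets containing [e] with
    those avoiding it. *)
Lemma card_balanced_mem (T : finType) (m : nat) (A : {set T}) (e : T) (b : bool) :
  e \in A ->
  (2 * #|[set Y : {set T} | [&& Y \subset A, #|Y| <= m & #|A :\: Y| <= m]
     && ((e \in Y) == b)]| = bal m #|A|)%N.
Proof.
move=> eA.
pose B b := [set Y : {set T} | [&& Y \subset A, #|Y| <= m & #|A :\: Y| <= m]
     && ((e \in Y) == b)]%N.
have AK (Y : {set T}) : Y \subset A -> A :\: (A :\: Y) = Y.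
  by move=> YA; rewrite setDDr setDv set0U (setIidPr YA).
have flip c : (#|B c| <= #|B (~~ c)|)%N.
  rewrite -(card_in_imset (f := fun Y => A :\: Y)); last first.
    move=> Y Z; rewrite !inE => /andP[/and3P[YA _ _] _] /andP[/and3P[ZA _ _] _] YZ.
    by rewrite -(AK _ YA) YZ AK.
  apply/subset_leq_card/fintype.subsetP => _ /imsetP[Y + ->].
  rewrite !inE eA => /andP[/and3P[YA Ym AYm] /eqP <-].
  by rewrite subDset finset.subsetUr AYm AK // Ym /=; case: (e \in Y).
have BE c : #|B c| = #|B b|.
  have [->//|/negPf cb] := eqVneq c b; have -> : b = ~~ c by case: c b cb => [] [].
  by apply/eqP; rewrite eqn_leq flip -{2}[c]negbK flip.
rewrite -card_balanced -[in RHS]sum1_card.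
rewrite (partition_big (J := bool) (fun Y : {set T} => e \in Y) predT) //=.
rewrite big_bool /= !sum1dep_card.
rewrite -[LHS]/(2 * #|B b|)%N mul2n -addnn -{1}(BE true) -(BE false).
by congr (_ + _)%N; apply: eq_card => Y; rewrite !inE.
Qed.

(** * Colorings without monochromatic stars *)

Section Graphs.
Variables (V : finType) (G : sgraph V).

Definition inc (v : V) : {set {set V}} := [set e in edges G | v \in e].

Definition adj (u v : V) : bool := [set u; v] \in edges G.

Lemma adjC u v : adj u v = adj v u.
Proof. by rewrite /adj finset.setUC. Qed.

Lemma adj_irr u : adj u u = false.
Proof.
apply/negP => /(forall_inP (edges_card2 G)).
by rewrite finset.setUid cards1.
Qed.

Lemma incP (v : V) (e : {set V}) : e \in edges G ->
  v \in e -> exists u, e = [set v; u].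
Proof.
move=> /(forall_inP (edges_card2 G)) /cards2P[x [y [_ ->]]].
rewrite !inE => /orP[] /eqP ->; first by exists y.
by exists x; rewrite finset.setUC.
Qed.

Lemma set2_inj (v : V) : injective (fun u => [set v; u]).
Proof.
move=> u u' /= E; have : u' \in [set v; u] by rewrite E set22.
have : u \in [set v; u'] by rewrite -E set22.
by rewrite !inE => /orP[/eqP ->|/eqP //] /orP[] /eqP.
Qed.

(* Sets of edges, seen as the first of two color classes. *)
Definition good (m : nat) : {set {set {set V}}} :=
  [set X : {set {set V}} | (X \subset edges G) &&
     [forall v, (#|X :&: inc v| <= m)%N && (#|inc v :\: X| <= m)%N]].

Lemma inc_imset (v : V) (X : {set {set V}}) : X \subset edges G ->
  X :&: inc v = [set [set v; u] | u in [set u | [set v; u] \in X]].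
Proof.
move=> XG; apply/setP => e; rewrite !inE; apply/idP/imsetP.
  case/and3P => eX eG /(incP eG)[u E].
  by exists u; rewrite ?inE -?E.
case=> u; rewrite inE => uX ->; rewrite uX (fintype.subsetP XG) //=.
by rewrite set21.
Qed.

Lemma card_inc (v : V) : #|inc v| = #|[set u | adj v u]|.
Proof.
rewrite -(card_imset _ (@set2_inj v)) -inc_imset //.
by rewrite (setIidPr _) //; apply/fintype.subsetP => e; rewrite inE => /andP[].
Qed.

Lemma has_copy_star (H : sgraph V) (t : nat) (v : V) :
  (t <= #|[set u | [set v; u] \in edges H]|)%N -> has_copy H (star t).
Proof.
set N := [set u | _] => tN.
pose s := take t (enum N).
have sz : size s = t by rewrite size_takel // -cardE.
have us : uniq s by rewrite take_uniq ?enum_uniq.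
(* The center [ord0] goes to [v], and the leaf [lift ord0 i] to entry [i] of [s]. *)
pose f := [ffun i : 'I_t.+1 => nth v (v :: s) i].
apply/existsP; exists f.
have sN x : x \in s -> [set v; x] \in edges H.
  by move=> /mem_take; rewrite mem_enum inE.
have vs : v \notin s.
  apply/negP => /sN; move/(forall_inP (edges_card2 H)).
  by rewrite finset.setUid cards1.
apply/andP; split.
  apply/injectiveP => i j; rewrite !ffunE => /eqP.
  by rewrite nth_uniq //= ?sz ?vs // => /eqP/val_inj.
apply/forall_inP => _ /imsetP[i _ ->].
rewrite finset.imsetU !imset_set1 !ffunE /=.
by rewrite add0n; apply: sN; rewrite mem_nth ?sz.
Qed.

(** With two colors, the first class determines the coloring, and its complement in [inc v] is the
    second class at [v]. *)
Lemma num_colorings_le_good m : (num_colorings 2 (star m.+1) G <= #|good m|)%N.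
Proof.
have memc (c : edge_coloring 2 G) i e (eG : e \in edges G) :
    (e \in color_edges c i) = (c (exist _ e eG) == i).
  apply/imsetP/idP => [[[e' e'G]] + E|ci].
    by rewrite inE => /eqP <-; apply/eqP; congr (c _); apply: val_inj.
  by exists (exist _ e eG); rewrite ?inE.
rewrite /num_colorings.
rewrite -(card_in_imset (f := fun c : edge_coloring 2 G => color_edges c ord0)).
  apply/subset_leq_card/fintype.subsetP => _ /imsetP[c + ->].
  rewrite inE negb_exists => /forallP nc.
  have cG i : color_edges c i \subset edges G.
    by apply/fintype.subsetP => _ /imsetP[[e eG] _ ->].
  have ci i v : (#|color_edges c i :&: inc v| <= m)%N.
    rewrite inc_imset // card_imset; last exact: set2_inj.
    rewrite leqNgt; apply/negP => h; case/negP: (nc i).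
    exact: (has_copy_star (H := color_class c i) h).
  rewrite inE cG; apply/forallP => v; rewrite ci.
  have -> : inc v :\: color_edges c ord0 = color_edges c ord_max :&: inc v.
    apply/setP => e; rewrite !inE; have [eG|] := boolP (e \in edges G); last first.
      by rewrite andbF /= andbF.
    by rewrite !memc; congr andb; case: (c _) => [[|[]]].
  by rewrite ci.
move=> c c' _ _ /setP E; apply/ffunP => -[e eG]; have := E e.
rewrite !memc -!val_eqE /= => cc'; apply: val_inj => /=; move: cc'.
by case: (c _) (c' _) => [[|[]]] //= ? [[|[]]].
Qed.

Lemma trace_inc_le m v : (#|trace (good m) (inc v)| <= bal m #|inc v|)%N.
Proof.
rewrite -card_balanced; apply/subset_leq_card/fintype.subsetP => _ /imsetP[X + ->].
rewrite !inE => /andP[_ /forallP/(_ v)/andP[Xm Xm']].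
by rewrite finset.subsetIr Xm setDIr setDv setU0.
Qed.

(** A trace on the double star is a pair of balanced sets at [u] and [v] that agree on the edge uv.
    For each of the two colors of uv, half of the balanced sets at each end qualify. *)
Lemma trace_inc2_le m u v : adj u v ->
  (2 * #|trace (good m) (inc u :|: inc v)| <= bal m #|inc u| * bal m #|inc v|)%N.
Proof.
move=> uv; pose e := [set u; v].
pose B v b := [set Y : {set {set V}} | [&& Y \subset inc v, #|Y| <= m & #|inc v :\: Y| <= m]
     && ((e \in Y) == b)]%N.
pose r (Y : {set {set V}}) := (Y :&: inc u, Y :&: inc v).
have rE X : r (X :&: (inc u :|: inc v)) = (X :&: inc u, X :&: inc v).
  by congr pair; rewrite -finset.setIA ?setUK // [_ :&: inc v]finset.setIC setKU.
rewrite -(card_in_imset (f := r)); last first.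
  move=> _ _ /imsetP[X _ ->] /imsetP[Y _ ->]; rewrite !rE => -[Eu Ev].
  by rewrite !setIUr Eu Ev.
have [ue ve] : u \in e /\ v \in e by rewrite /e set21 set22.
have eG : e \in edges G by [].
have eu : e \in inc u by rewrite inE eG.
have ev : e \in inc v by rewrite inE eG.
have sub : r @: trace (good m) (inc u :|: inc v) \subset
    finset.setX (B u true) (B v true) :|: finset.setX (B u false) (B v false).
  apply/fintype.subsetP => _ /imsetP[_ /imsetP[X + ->] ->].
  rewrite rE !inE => /andP[_ /forallP Xm].
  have [/andP[Xu Xu'] /andP[Xv Xv']] := (Xm u, Xm v).
  rewrite !finset.subsetIr !setDIr !setDv !setU0 Xu Xu' Xv Xv' eG !eqxx orbT /=.
  by rewrite !andbT; case: (e \in X).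
have := leq_trans (subset_leq_card sub) (leq_card_setU _ _).
rewrite !cardsX; set k := #|_|.
have := @card_balanced_mem _ m (inc u) e true eu.
have := @card_balanced_mem _ m (inc u) e false eu.
have := @card_balanced_mem _ m (inc v) e true ev.
have := @card_balanced_mem _ m (inc v) e false ev.
rewrite -/(B u true) -/(B u false) -/(B v true) -/(B v false).
move=> v0 v1 u0 u1; rewrite -(leq_pmul2l (ltn0Sn 1)) => /leq_trans; apply.
rewrite -(leq_pmul2l (ltn0Sn 1)).
rewrite [leqRHS](_ : _ = bal m #|inc u| * bal m #|inc v| +
  bal m #|inc u| * bal m #|inc v|)%N; last by lia.
rewrite -{1}u1 -{1}v1 -u0 -v0; lia.
Qed.

Lemma inc_le m v : good m != set0 -> (#|inc v| <= 2 * m)%N.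
Proof.
case/set0Pn => X; rewrite inE => /andP[_ /forallP/(_ v)/andP[]].
by rewrite cardsD finset.setIC; lia.
Qed.

Lemma bal_inc_gt0 m v : good m != set0 -> (0 < bal m #|inc v|)%N.
Proof. by move=> g0; rewrite (leq_trans _ (trace_inc_le m v)) ?card_trace_gt0. Qed.

End Graphs.

(** * Shearer's inequality for stars and double stars *)

Section EntropyBound.
Variables (R : realType) (V : finType) (G : sgraph V).

(** Within an edge, each end has exactly one neighbor, the other end. *)
Lemma sum_inc (eps : V -> R) (e : {set V}) : e \in edges G ->
  \sum_(u in e) \sum_(v in e | adj G u v) eps u = \sum_(u in e) eps u.
Proof.
move=> eG; have /cards2P[x [y [xy E]]] := forall_inP (edges_card2 G) _ eG.
have axy : adj G x y by rewrite /adj -E.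
rewrite E !big_setU1 ?inE //= !big_set1; congr (_ + _).
  by rewrite big_mkcondr big_setU1 ?inE //= big_set1 adj_irr axy add0r.
by rewrite big_mkcondr big_setU1 ?inE //= big_set1 adj_irr adjC axy addr0.
Qed.

Lemma sum_adj (a : R) (u : V) : \sum_(v | adj G u v) a = #|inc G u|%:R * a.
Proof. by rewrite card_inc cardsE mulr_natl sumr_const. Qed.

(* Each edge e = {x, y} is covered with total weight exactly 1 by the sets [inc G x], of
   weight [wv x] below, and [inc G u :|: inc G v], of weight [eps u] for every ordered
   pair (u, v) of adjacent vertices: x and y contribute 1 / 2 each, the terms in [eps]
   cancelling because both parts of the union for (x, y) and (y, x) contain e. *)
Lemma ln_card_good_le (m : nat) (eps : V -> R) :
    (forall x, 0 <= eps x) ->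
    (forall x, #|inc G x|%:R * eps x + \sum_(u | adj G x u) eps u <= 1 / 2 + eps x) ->
    good G m != set0 ->
  ln #|good G m|%:R <= \sum_x ((1 / 2 + eps x) * ln (bal m #|inc G x|)%:R -
                              #|inc G x|%:R * eps x * ln 2).
Proof.
move=> eps0 epsle g0; pose E x := \sum_(u | adj G x u) eps u.
pose wv x := 1 / 2 + eps x - #|inc G x|%:R * eps x - E x.
pose S (j : V + V * V) := match j with
  | inl x => inc G x | inr p => inc G p.1 :|: inc G p.2 end.
pose w (j : V + V * V) := match j with
  | inl x => wv x | inr p => if adj G p.1 p.2 then eps p.1 else 0 end.
have wv0 x : 0 <= wv x by rewrite /wv /E; have := epsle x; lra.
have w0 j : 0 <= w j by case: j => [x|[u v]] //=; case: ifP.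
have cover e : e \in edges G -> 1 <= \sum_(j | e \in S j) w j.
  move=> eG; have iE x : (e \in inc G x) = (x \in e) by rewrite inE eG.
  rewrite big_sumType /=; under eq_bigl do rewrite iE.
  have -> : \sum_(p | e \in inc G p.1 :|: inc G p.2)
        (if adj G p.1 p.2 then eps p.1 else 0) =
      \sum_(x in e) #|inc G x|%:R * eps x + \sum_(x in e) E x - \sum_(x in e) eps x.
    (* Inclusion-exclusion: pairs with [u] in [e], plus pairs with [v] in [e], minus pairs with
       both. *)
    transitivity (\sum_u \sum_v ((if u \in e then if adj G u v then eps u else 0 else 0) +
        (if v \in e then if adj G v u then eps u else 0 else 0) -
        (if u \in e then if v \in e then if adj G u v then eps u else 0 else 0 else 0))).
      rewrite pair_big big_mkcond /=; apply: eq_bigr => -[u v] _ /=.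
      rewrite inE !iE (adjC G v u).
      by case: (u \in e) (v \in e) => [] []; rewrite /= ?addrK ?addr0 ?add0r ?subr0.
    under eq_bigr do rewrite sumrB big_split /=.
    rewrite sumrB big_split /=; congr (_ + _ - _).
    - rewrite [RHS]big_mkcond; apply: eq_bigr => u _; case: ifP => _.
        by rewrite -big_mkcond sum_adj.
      by rewrite big1.
    - rewrite exchange_big [RHS]big_mkcond; apply: eq_bigr => u _ /=; case: ifP => _.
        by rewrite -big_mkcond.
      by rewrite big1.
    rewrite -sum_inc // [RHS]big_mkcond; apply: eq_bigr => u _; case: ifP => _.
      by rewrite [RHS]big_mkcond; apply: eq_bigr => v _; case: (v \in e).
    by rewrite big1.
  rewrite /wv !sumrB big_split /= sumr_const.
  have /eqP -> := forall_inP (edges_card2 G) _ eG.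
  by rewrite mulr2n; lra.
have sub X : X \in good G m -> X \subset edges G by rewrite inE => /andP[].
have := shearer w0 cover sub g0.
pose tr j := #|trace (good G m) (S j)|%:R : R.
have tr0 j : 0 < tr j by rewrite ltr0n card_trace_gt0.
have -> : \prod_j tr j `^ w j = expR (\sum_j w j * ln (tr j)).
  rewrite expR_sum; apply: eq_bigr => j _.
  by rewrite /powR gt_eqF.
rewrite -[X in X <= _]lnK ?posrE ?ltr0n ?card_gt0 // ler_expR => /le_trans; apply.
pose l x : R := ln (bal m #|inc G x|)%:R.
have lE x : ln (tr (inl x)) <= l x.
  by rewrite ler_ln ?posrE ?tr0 ?ltr0n ?bal_inc_gt0 // ler_nat trace_inc_le.
have lE2 u v : adj G u v -> ln (tr (inr (u, v))) <= l u + l v - ln 2.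
  move=> uv; rewrite -lnM ?posrE ?ltr0n ?bal_inc_gt0 //.
  rewrite -ln_div ?posrE ?mulr_gt0 ?ltr0n ?bal_inc_gt0 //.
  rewrite ler_ln ?posrE ?tr0 ?divr_gt0 ?mulr_gt0 ?ltr0n ?bal_inc_gt0 //.
  by rewrite ler_pdivlMr // mulrC -!natrM ler_nat trace_inc2_le.
rewrite big_sumType /=.
apply: (@le_trans _ _ (\sum_x wv x * l x +
    \sum_u \sum_(v | adj G u v) eps u * (l u + l v - ln 2))).
  apply: lerD; first by apply: ler_sum => x _; rewrite ler_wpM2l.
  rewrite pair_big_dep /= [leRHS]big_mkcond; apply: ler_sum => -[u v] _ /=.
  by case: ifP => uv; rewrite ?mul0r // ler_wpM2l ?lE2.
(* Regrouping by vertex: by symmetry of adjacency the terms [eps u * l v] collect into [E v * l v],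
   which cancels the [- E v] in [wv v]. *)
have -> : \sum_u \sum_(v | adj G u v) eps u * (l u + l v - ln 2) =
    \sum_u #|inc G u|%:R * (eps u * (l u - ln 2)) + \sum_u E u * l u.
  transitivity (\sum_u (\sum_(v | adj G u v) eps u * (l u - ln 2) +
      \sum_(v | adj G u v) eps u * l v)).
    by apply: eq_bigr => u _; rewrite -big_split; apply: eq_bigr => v _ /=; ring.
  rewrite big_split /=; congr (_ + _).
    by apply: eq_bigr => u _; rewrite sum_adj.
  rewrite (exchange_big_dep predT) //=; apply: eq_bigr => v _.
  by rewrite /E mulr_suml; apply: eq_bigl => u; rewrite adjC.
rewrite -!big_split /= le_eqVlt; apply/orP; left; apply/eqP/eq_bigr => x _.
by rewrite /wv -/(l x); ring.
Qed.

End EntropyBound.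

(** * Optimizing the weights *)

Section Weights.
Variables (R : realType) (m : nat).
Hypothesis m3 : (3 <= m)%N.

Let M : R := m%:R.
Let eps : R := 1 / (2 * (4 * M - 3)).
Let lnC : R := ln 'C(2 * m, m)%:R.

(* 1 / (2 (4 m - 3)) is the largest constant weight satisfying [vweight_sum_le] when
   all degrees are at most 2 m - 1; the first branch is the largest value for a vertex of
   degree 2 m whose neighbors have that weight. *)
Definition vweight (d : nat) : R :=
  if d == (2 * m)%N then (2 * m%:R - 3) / (2 * m%:R - 1) * (1 / (2 * (4 * m%:R - 3)))
  else 1 / (2 * (4 * m%:R - 3)).

Let M3 : 3 <= M. Proof. by rewrite ler_nat. Qed.

Let M43 : 4 * M - 3 != 0. Proof. by apply: lt0r_neq0; have := M3; lra. Qed.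

Let M21 : 2 * M - 1 != 0. Proof. by apply: lt0r_neq0; have := M3; lra. Qed.

Let eps_gt0 : 0 < eps. Proof. by rewrite /eps divr_gt0 //; have := M3; lra. Qed.

Let epsE : eps * (4 * M - 3) = 1 / 2.
Proof. by rewrite /eps; field; rewrite ?M43 ?M21. Qed.

Let vweight_top : (2 * M - 1) * vweight (2 * m) = (2 * M - 3) * eps.
Proof. by rewrite /vweight eqxx -/M -/eps; field; rewrite ?M43 ?M21. Qed.

Let vweight_lt d : (d < 2 * m)%N -> vweight d = eps.
Proof. by move=> dm; rewrite /vweight ltn_eqF. Qed.

Lemma vweight_ge0 d : 0 <= vweight d.
Proof.
have := M3; have := eps_gt0; rewrite /vweight -/M -/eps => e0 hM.
case: ifP => _; last exact: ltW.
by apply: mulr_ge0; [apply: divr_ge0; lra|apply: ltW].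
Qed.

Lemma vweight_le d : vweight d <= eps.
Proof.
have := M3; have := eps_gt0; rewrite /vweight -/M -/eps => e0 hM.
case: ifP => _ //; apply: ler_piMl; first exact: ltW.
by rewrite ler_pdivrMr; lra.
Qed.

(** This is the nonnegativity condition of [ln_card_good_le], with every neighbor's weight raised to
    [eps]. Equality holds at degrees 2m - 1 and 2m. *)
Lemma vweight_sum_le d : (d <= 2 * m)%N ->
  d%:R * vweight d + d%:R * eps <= 1 / 2 + vweight d.
Proof.
have := M3; have := eps_gt0; have := epsE => eE e0 hM.
rewrite leq_eqVlt => /predU1P[->|dm].
  by have := vweight_top; rewrite natrM -/M; nra.
have : d%:R <= 2 * M - 1 by rewrite lerBrDr -natrM natr1 ler_nat.
by rewrite vweight_lt //; nra.
Qed.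

Let C_gt0 : (0 < 'C(2 * m, m))%N. Proof. by rewrite bin_gt0; lia. Qed.

(** The bound is the cost at d = 2m - 1. Degree 2m has the same [bal] but a smaller weight; at lower
    degrees the drop in [ln (bal m d)] outweighs the smaller [ln 2] term. *)
Lemma vertex_cost d : (d <= 2 * m)%N -> (0 < bal m d)%N ->
  (1 / 2 + vweight d) * ln (bal m d)%:R - d%:R * vweight d * ln 2 <=
  (2 * M - 1) / (4 * M - 3) * (lnC - ln 2 / 2).
Proof.
move=> dm b0; have := M3; have := eps_gt0; have := epsE => eE e0 hM.
have l2 : 0 < ln 2 :> R by rewrite ln_gt0 ?ltr1n.
have -> : (2 * M - 1) / (4 * M - 3) = (4 * M - 2) * eps.
  by rewrite /eps; field; rewrite ?M43 ?M21.
move: dm; rewrite leq_eqVlt => /predU1P[d2m|dm].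
  rewrite d2m bal_2m -/lnC natrM -/M.
  have lnCl : (M + 1) * ln 2 <= lnC.
    rewrite natr1 mulr_natl -lnXn // /lnC -natrX.
    by rewrite ler_ln ?posrE ?ltr0n ?expn_gt0 // ler_nat exp2_le_bin.
  have vt := vweight_top.
  set v := vweight _ in vt *; have vE : v = (2 * M - 3) * eps / (2 * M - 1).
    by rewrite -vt; field; rewrite ?M43 ?M21.
  rewrite -subr_ge0.
  have -> : (4 * M - 2) * eps * (lnC - ln 2 / 2) - ((1 / 2 + v) * lnC - 2 * M * v * ln 2) =
    eps / (2 * M - 1) * (2 * lnC - (2 * M + 1) * ln 2).
    by rewrite -eE vE; field; rewrite ?M43 ?M21.
  by rewrite mulr_ge0 ?divr_ge0 ?ltW //; lra.
rewrite vweight_lt //; set l := ln _.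
rewrite -subr_ge0.
have -> : (4 * M - 2) * eps * (lnC - ln 2 / 2) - ((1 / 2 + eps) * l - d%:R * eps * ln 2) =
    eps * ((4 * M - 2) * (lnC - l) - (2 * M - 1 - d%:R) * ln 2).
  by rewrite -eE; field.
apply: mulr_ge0; first exact: ltW.
have [d1|d1] := eqVneq d (2 * m).-1.
  have -> : l = lnC by rewrite /l /lnC d1 bal_2m1 //; lia.
  have -> : d%:R = 2 * M - 1 :> R.
    by apply/eqP; rewrite -subr_eq opprK natr1 d1 prednK ?natrM //; lia.
  by lra.
have [d2|d2] := eqVneq d (2 * m - 2)%N.
  have -> : d%:R = 2 * M - 2 :> R.
    by rewrite d2 natrB ?natrM //; lia.
  suff : ln 2 <= 3 * (lnC - l) by nra.
  rewrite mulrBr lerBrDr.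
  have h (x : nat) : (0 < x)%N -> 3 * ln x%:R = ln (x ^ 3)%:R :> R.
    by move=> x0; rewrite natrX lnXn ?ltr0n // mulr_natl.
  rewrite /l /lnC !h // -lnM ?posrE ?ltr0n ?expn_gt0 ?b0 // -natrM.
  rewrite ler_ln ?posrE ?ltr0n ?muln_gt0 ?expn_gt0 ?b0 ?C_gt0 // ler_nat d2.
  have := @bal_2m2 m; set b := bal _ _; set c := 'C(_, _) => /(_ (ltnW (ltnW m3))) bc.
  (* From 64 b^3 <= 27 c^3 follows 2 b^3 <= c^3. *)
  have : ((4 * b) ^ 3 <= (3 * c) ^ 3)%N by rewrite leq_exp2r.
  by rewrite !expnMn; lia.
have d3 : (d <= 2 * m - 3)%N by lia.
(* From here on [bal] has at least halved, and the factor 4m - 2 exceeds 2m - 1 - d. *)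
have : ln 2 <= lnC - l.
  rewrite lerBrDr /l /lnC -lnM ?posrE ?ltr0n // -natrM.
  rewrite ler_ln ?posrE ?ltr0n ?muln_gt0 ?b0 ?C_gt0 // ler_nat.
  rewrite (leq_trans _ (bal_2m3 _)) ?(ltnW m3) // leq_mul2l leq_bal //; lia.
have : 0 <= d%:R :> R by [].
nra.
Qed.

End Weights.

(** * From the vertex costs to the growth constant *)

Lemma num_colorings_star_le (R : realType) (m n : nat) (G : sgraph 'I_n) : (3 <= m)%N ->
  (num_colorings 2 (star m.+1) G)%:R <=
    expR (n%:R * ((2 * m%:R - 1) / (4 * m%:R - 3) *
      (ln 'C(2 * m, m)%:R - ln 2 / 2))) :> R.
Proof.
move=> m3; set B := _ / _ * _.
apply: (@le_trans _ _ #|good G m|%:R); first by rewrite ler_nat num_colorings_le_good.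
(* A nonempty [good G m] forces all degrees to be at most 2m, as the weight estimates require. *)
have [->|g0] := eqVneq (good G m) set0; first by rewrite cards0 expR_ge0.
rewrite -[leLHS]lnK ?posrE ?ltr0n ?card_gt0 // ler_expR.
apply: le_trans (ln_card_good_le (eps := fun x => vweight R m #|inc G x|) _ _ g0) _.
- by move=> x; apply: vweight_ge0.
- move=> x; apply: le_trans (vweight_sum_le R m3 (inc_le x g0)).
  by rewrite lerD2l -sum_adj; apply: ler_sum => u _; apply: vweight_le.
have -> : n%:R * B = \sum_(x : 'I_n) B by rewrite sumr_const card_ord mulr_natl.
apply: ler_sum => x _.
by apply: vertex_cost; rewrite ?inc_le ?bal_inc_gt0.
Qed.

Lemma growth_limit_le (R : realType) (r : nat) (W : finType) (H : sgraph W) (B : R) :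
  (forall n (G : sgraph 'I_n), (num_colorings r H G)%:R <= expR (n%:R * B)) ->
  (growth_limit R r H <= (expR B)%:E)%E.
Proof.
move=> le_num; rewrite /growth_limit; set u := (X in lim (X @ _)%classic).
(* The limit of a divergent sequence is the junk value 0. *)
have [cu|/dvgP ->] := pselect (cvg (u @ \oo)%classic); last first.
  by rewrite lee_fin expR_ge0.
apply: lime_le => //; near=> n; rewrite /u lee_fin.
have n0 : (0 < n)%N by near: n; exists 1%N.
have -> : expR B = expR (n%:R * B) `^ n%:R^-1.
  by rewrite -expRM mulrAC divff ?mul1r // pnatr_eq0 -lt0n.
apply: ge0_ler_powR; rewrite ?nnegrE ?expR_ge0 ?invr_ge0 //.
rewrite /max_colorings.
elim/big_ind: _ => [|x y hx hy|G _]; first exact: expR_ge0.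
  by rewrite /maxn; case: ifP.
exact: le_num.
Unshelve. all: by end_near. Qed.

Theorem theorem8 (R : realType) :
  exists t0 : nat, forall t : nat, (t0 <= t)%N ->
    (growth_limit R 2 (star t) <=
     ((Num.sqrt 2 / 2 * 'C(2 * t - 2, t - 1)%:R)
        `^ ((2 * t%:R - 3) / (4 * t%:R - 7)))%:E)%E.
Proof.
(* With t = m + 1, the condition m >= 3 becomes t >= 4. *)
exists 4%N => -[//|m]; rewrite ltnS => m3.
rewrite (_ : 2 * m.+1 - 2 = 2 * m)%N ?subn1 /=; last lia.
set c := 'C(_, _); have c0 : (0 < c)%N by rewrite bin_gt0; lia.
(* This factor is the source of the term [- ln 2 / 2] in the exponent. *)
have s2 : Num.sqrt 2 / 2 = 2 `^ (- 2^-1) :> R.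
  rewrite powRN powR12_sqrt // -[X in _ / X](sqr_sqrtr (ler0n R 2)).
  by field; rewrite gt_eqF ?sqrtr_gt0.
have -> : (Num.sqrt 2 / 2 * c%:R) `^ ((2 * m.+1%:R - 3) / (4 * m.+1%:R - 7)) =
   expR ((2 * m%:R - 1) / (4 * m%:R - 3) * (ln c%:R - ln 2 / 2)) :> R.
  have p0 : 0 < 2 `^ (- 2^-1) * c%:R :> R by rewrite mulr_gt0 ?powR_gt0 ?ltr0n.
  rewrite s2 /powR gt_eqF // lnM ?posrE ?powR_gt0 ?ltr0n // ln_powR; congr expR.
  by rewrite -natr1; congr (_ / _ * _); lra.
by apply: growth_limit_le => n G; apply: num_colorings_star_le.
Qed.
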